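(* Let $n$ be a positive integer. Suppose given points $\alpha_1,\ldots,\alpha_{k_0}\in\mathbb D$ and $\tau_1,\ldots,\tau_{k_1}\in\mathbb T$, where $2k_0+k_1=n$, and points $\sigma_1,\ldots,\sigma_n\in\overline{\mathbb D}$ distinct from $\tau_1,\ldots,\tau_{k_1}$ (that is, $\sigma_i\ne\tau_j$ for all $i,j$). Then there exists a rational $\Gamma$-inner function $h=(s,p)$ of degree $n$ such that (1) the zeros of $s$ in $\overline{\mathbb D}$, repeated according to multiplicity, are $\alpha_1,\ldots,\alpha_{k_0},\tau_1,\ldots,\tau_{k_1}$; (2) the royal nodes of $h$, repeated according to multiplicity, are $\sigma_1,\ldots,\sigma_n$. Such a function $h$ can be constructed as follows. Let $t_+>0$ and $t\in\mathbb R\setminus\{0\}$, write $\tau_j=e^{i\theta_j}$ with $0\le\theta_j<2\pi$, and define $$R(\lambda)=t_+\prod_{j=1}^n(\lambda-\sigma_j)(1-\overline{\sigma_j}\lambda),\qquad E(\lambda)=t\prod_{j=1}^{k_0}(\lambda-\alpha_j)(1-\overline{\alpha_j}\lambda)\prod_{j=1}^{k_1}ie^{-i\theta_j/2}(\lambda-\tau_j).$$ (i) There exists an outer polynomial $D$ of degree at most $n$ such that $$\lambda^{-n}R(\lambda)+|E(\lambda)|^2=4|D(\lambda)|^2\quad\text{for all }\lambda\in\mathbb T.$$ (ii) For any such $D$, the function $$h=(s,p)=\left(\frac{E}{D},\frac{D^{\sim n}}{D}\right)$$ is a rational $\Gamma$-inner function with $\deg(h)=n$, conditions (1) and (2) hold,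 and the royal polynomial of $h$ is $R$.
   Context: $\mathbb D$ is the open unit disc in $\mathbb C$ and $\mathbb T$ the unit circle. A polynomial $D$ is outer if $D(\lambda)\ne0$ for all $\lambda\in\mathbb D$. $\mathcal G=\{(z+w,zw):z,w\in\mathbb D\}\subset\mathbb C^2$, $\Gamma=\overline{\mathcal G}$, and $b\Gamma$ is the distinguished boundary of $\Gamma$; explicitly $b\Gamma=\{(s,p)\in\mathbb C^2:|s|\le2,\ |p|=1,\ s=\overline s p\}$. A rational $\Gamma$-inner function is a rational analytic map $h=(s,p):\mathbb D\to\Gamma$ whose (continuous) extension to $\overline{\mathbb D}$ maps $\mathbb T$ into $b\Gamma$. Its degree $\deg(h)$ is the nonnegative integer $|h_*(1)|$, where $h_*:\mathbb Z=\pi_1(\mathbb T)\to\pi_1(b\Gamma)\cong\mathbb Z$ is induced by $h|_{\mathbb T}:\mathbb T\to b\Gamma$; it equals the degree of the finite Blaschke product $p$. The royal variety is $\mathcal R=\{(2z,z^2):z\in\mathbb C\}$. A royal node of $h$ is a point $\lambda\in\overline{\mathbb D}$ with $h(\lambda)\in\mathcal R$. For a polynomial $f$ of degree at most $n$ put $f^{\sim n}(\lambda)=\lambda^n\overline{f(1/\overline\lambda)}$. If $h=(s,p)$ is rational $\Gamma$-inner of degree $n$, there are polynomials $E_h,D_h$ of degree at most $n$, unique up to a common nonzero real factor, with $E_h^{\sim n}=E_h$, $D_h\ne0$ on $\overline{\mathbb D}$, $|E_h|\le2|D_h|$ on $\overline{\mathbb D}$, $s=E_h/D_h$ and $p=D_h^{\sim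 n}/D_h$ on $\overline{\mathbb D}$. The royal polynomial of $h$ is $4D_hD_h^{\sim n}-E_h^2$; it is determined by $h$ only up to a positive factor. The royal nodes of $h$ are exactly the zeros of its royal polynomial in $\overline{\mathbb D}$. When $h(\overline{\mathbb D})\not\subseteq\mathcal R\cap\Gamma$, the multiplicity of a royal node $\sigma$ that is a zero of the royal polynomial of order $\ell$ is $\ell$ if $\sigma\in\mathbb D$ and $\ell/2$ if $\sigma\in\mathbb T$ (in which case $\ell$ is even). Repetitions are allowed in the lists of points. *)

(* Defs.v *)
From HB Require Import structures.
From mathcomp Require Export all_boot all_order all_algebra.
From mathcomp Require Export complex.
From mathcomp Require Export all_classical all_reals all_analysis.
Export Order.TTheory GRing.Theory Num.Theory.
Export numFieldNormedType.Exports.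

Set Implicit Arguments.
Unset Strict Implicit.
Unset Printing Implicit Defensive.

Local Open Scope classical_set_scope.
Local Open Scope ring_scope.

(* R[i], typed as a numClosedFieldType: this is what gives access to the
   library's norm topology, which has no instance on R[i] itself. *)
Definition Cplx (R : realType) : numClosedFieldType := R[i].

Section Definitions.
Context {R : realType}.
Local Notation C := (Cplx R).

Definition rc (x : R) : C := (x%:C)%C.

Definition expi (x : R) : C := (cos x +i* sin x)%C.

Definition disc : set C := [set z | `|z| < 1].
Definition cdisc : set C := [set z | `|z| <= 1].
Definition circle : set C := [set z | `|z| = 1].

Definition symbidisc : set (C * C) :=
  [set (z + w, z * w) | z in disc & w in disc].

Definition Gam : set (C * C) := closure symbidisc.

Definition bGam : set (C * C) :=
  [set x | [/\ `|x.1| <= 2, `|x.2| = 1 & x.1 = (x.1)^* * x.2]].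

Definition royal_variety : set (C * C) :=
  [set (2 * z, z ^+ 2) | z in [set: C]].

(* A function on the closed disc is represented by a total function on C whose
   values off the closed disc are never used. *)

Definition rational_analytic (f : C -> C) : Prop :=
  exists N D : {poly C}, forall z, disc z -> D.[z] != 0 /\ f z = N.[z] / D.[z].

(* The values of h on the circle are those of its continuous extension. *)
Definition rational_Gamma_inner (h : C -> C * C) : Prop :=
  [/\ rational_analytic (fun z => (h z).1) /\
      rational_analytic (fun z => (h z).2),
      forall z, disc z -> Gam (h z),
      {within cdisc, continuous h} &
      forall z, circle z -> bGam (h z)].

Definition loop_homotopic (X : set (C * C)) (f g : C -> C * C) : Prop :=
  exists H : R * C -> C * C,
    [/\ {within `[0, 1]%classic `*` circle, continuous H},
        forall u z, u \in `[0, 1] -> circle z -> X (H (u, z)),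
        forall z, circle z -> H (0, z) = f z &
        forall z, circle z -> H (1, z) = g z].

(* bGam retracts onto its core circle {0} x T by (s, p) |-> ((1 - u) s, p), so
   the class of z |-> (0, z) generates pi_1(bGam), and z |-> (0, z ^ k)
   represents k times this generator.  As pi_1(bGam) is abelian, elements of it
   are the same as free homotopy classes of maps from the circle to bGam, and
   h_*(1) is the class of the restriction of h to the circle.  Thus the relation
   below says |h_*(1)| = n. *)
Definition Gamma_degree (h : C -> C * C) (n : nat) : Prop :=
  loop_homotopic bGam h (fun z => (0, z ^+ n)) \/
  loop_homotopic bGam h (fun z => (0, z ^- n)).

(* For f of degree at most n, this is z ^ n * conj (f (1 / conj z)). *)
Definition reversal (n : nat) (f : {poly C}) : {poly C} :=
  \poly_(i < n.+1) (f`_(n - i))^*.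

Definition outer (D : {poly C}) : Prop := forall z, disc z -> D.[z] != 0.

(* A relation rather than a function, as the royal polynomial is determined by
   h only up to a positive factor. *)
Definition royal_polynomial (h : C -> C * C) (P : {poly C}) : Prop :=
  exists n (E D : {poly C}),
    [/\ Gamma_degree h n,
        (size E <= n.+1)%N /\ (size D <= n.+1)%N,
        reversal n E = E,
        forall z, cdisc z ->
          [/\ D.[z] != 0, `|E.[z]| <= 2 * `|D.[z]| &
              h z = (E.[z] / D.[z], (reversal n D).[z] / D.[z])] &
        P = 4 *: (D * reversal n D) - E ^+ 2].

Definition royal_node (h : C -> C * C) (z : C) : Prop :=
  cdisc z /\ royal_variety (h z).

Definition royal_node_multiplicity (h : C -> C * C) (z : C) (m : nat) : Prop :=
  [/\ royal_node h z,
      ~ (h @` cdisc `<=` royal_variety `&` Gam) &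
      exists P, [/\ royal_polynomial h P,
                    disc z -> mup z P = m &
                    circle z -> mup z P = m.*2]].

Definition royal_nodes_with_multiplicity (h : C -> C * C) (l : seq C) : Prop :=
  (forall z, royal_node h z <-> z \in l) /\
  (forall z, z \in l -> royal_node_multiplicity h z (count_mem z l)).

(* Order of the zero a in the closed disc of a nonzero rational function f with
   no pole there; it does not depend on the chosen quotient. *)
Definition zero_order (f : C -> C) (a : C) (m : nat) : Prop :=
  exists N D : {poly C},
    [/\ forall z, cdisc z -> D.[z] != 0 /\ f z = N.[z] / D.[z],
        N != 0 & mup a N = m].

Definition cdisc_zeros_with_multiplicity (f : C -> C) (l : seq C) : Prop :=
  (forall z, cdisc z /\ f z = 0 <-> z \in l) /\
  (forall z, z \in l -> zero_order f z (count_mem z l)).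

Definition Rpoly (tp : R) (sigma : seq C) : {poly C} :=
  rc tp *: \prod_(a <- sigma) (('X - a%:P) * (1 - a^* *: 'X)).

Definition Epoly (t : R) (alpha : seq C) (k1 : nat) (tau : k1.-tuple C)
    (theta : k1.-tuple R) : {poly C} :=
  rc t *: ((\prod_(a <- alpha) (('X - a%:P) * (1 - a^* *: 'X))) *
           \prod_(j < k1)
              (('i * expi (- (tnth theta j / 2))) *: ('X - (tnth tau j)%:P))).

Definition inner_of (n : nat) (E D : {poly C}) : C -> C * C :=
  fun z => (E.[z] / D.[z], (reversal n D).[z] / D.[z]).

End Definitions.

(* Main.v *)
Require Import Defs.
From mathcomp Require Import ring lra zify.

(** Write D~ for the reversal z^n conj (D (1 / conj z)) of D, and put s = E / D,
    p = D~ / D.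

    Both E and the polynomial P are symmetric under reversal, so on the circle
    z^-n P + |E|^2 = z^-n (P + E^2).  The first summand is a positive multiple
    of the product of the |z - sigma_j|^2 and the second vanishes only at the
    tau_j; as no sigma_j is a tau_j, the sum is strictly positive.  A strictly
    positive trigonometric polynomial is a squared modulus |2 D|^2 with D
    without zeros in the closed disc ([fejer_riesz_pos]); since the positivity
    is strict, zeros of even order on the circle need not be considered.  It
    also shows that every outer D with this property is nonzero on the circle.

    Fix such a D.  On the circle, conj D = z^-n D~ turns the defining equation
    into 4 D D~ - E^2 = P, and two polynomials that agree on the circle are
    equal ([poly_circle_inj]); hence P is the royal polynomial, and
    4 p - s^2 = P / D^2 gives the royal nodes.  Zeros and multiplicities are
    then read off the factorisations of E and P ([Epoly_factor],
    [mup_blaschke_prod]).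

    On the circle |E| <= 2 |D|, because z^-n P >= 0, and the symmetry of E gives
    s = conj s * p; so h maps the circle to the distinguished boundary.  By the
    maximum modulus principle ([maximum_modulus]) |E| <= 2 |D| on the whole
    disc.  To see that h maps the disc to Gamma, let 0 <= r < 1 and |w| = 1.
    Then M = 2 D - w r E has no zero in the closed disc, so that |M~| < |M| in
    the disc by the factorisation of M ([reversal_lt]); division by |D| turns
    this into |2 w p - r s| < |2 - w r s|.  When this holds for every w, both
    roots of X^2 - r s X + p lie in the disc ([symbidisc_criterion]), which
    means that (r s, p) lies in the symmetrised bidisc; let r tend to 1.

    For the degree, the loop p = z^n conj D / D is deformed by moving D, through
    functions that do not vanish on the circle, to a real constant, while s is
    shrunk to 0 ([inner_of_degree]). *)

Set Implicit Arguments.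
Unset Strict Implicit.
Unset Printing Implicit Defensive.

Local Open Scope classical_set_scope.
Local Open Scope ring_scope.

Section Construction.
Context {R : realType}.
Local Notation C := (Cplx R).
Implicit Types (z a : C) (f g D E G P : {poly C}) (s : seq C).

(** * Real scalars among the complex numbers *)

Lemma rcD (x y : R) : rc (x + y) = rc x + rc y.
Proof. exact: (rmorphD (real_complex R)). Qed.

Lemma rcM (x y : R) : rc (x * y) = rc x * rc y.
Proof. exact: (rmorphM (real_complex R)). Qed.

Lemma rcB (x y : R) : rc (x - y) = rc x - rc y.
Proof. exact: (rmorphB (real_complex R)). Qed.

Lemma rc0 : rc (0 : R) = 0. Proof. by []. Qed.
Lemma rc1 : rc (1 : R) = 1. Proof. by []. Qed.

Lemma rc_ge0 (x : R) : (0 <= rc x) = (0 <= x).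
Proof. exact: lecR. Qed.

Lemma rc_gt0 (x : R) : (0 < rc x) = (0 < x).
Proof. exact: ltcR. Qed.

Lemma rc_le1 (x : R) : (rc x <= 1) = (x <= 1).
Proof. exact: lecR. Qed.

Lemma rc_lt1 (x : R) : (rc x < 1) = (x < 1).
Proof. exact: ltcR. Qed.

Lemma norm_rc (x : R) : `|rc x| = rc `|x|.
Proof.
have [x0|x0] := leP 0 x; first by rewrite !ger0_norm// rc_ge0.
rewrite !ltr0_norm//; first exact/esym/(rmorphN (real_complex R)).
exact: (etrans (ltcR _ _)).
Qed.

Lemma rc_real (x : R) : rc x \is Num.real.
Proof. by apply/complex_realP; exists x. Qed.

Lemma rc_conj (x : R) : (rc x)^* = rc x.
Proof. exact/CrealP/rc_real. Qed.

Lemma realE (x : C) : x \is Num.real -> exists y : R, x = rc y.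
Proof. by move=> /complex_realP. Qed.

(** * Polynomials on the unit circle *)

Lemma circle_mulJ z : circle z -> z * z^* = 1.
Proof. by rewrite /circle /= => z1; rewrite -normCK z1 expr1n. Qed.

Lemma circle_neq0 z : circle z -> z != 0.
Proof. by rewrite /circle /= => z1; rewrite -normr_gt0 z1. Qed.

Lemma circle_conj z : circle z -> z^* = z^-1.
Proof.
move=> z1; have z0 := circle_neq0 z1.
by apply: (mulfI z0); rewrite circle_mulJ// divff.
Qed.

Lemma circle_cdisc z : circle z -> cdisc z.
Proof. by rewrite /circle /cdisc /= => ->. Qed.

Lemma disc_cdisc z : disc z -> cdisc z.
Proof. exact: ltW. Qed.

Lemma cdiscP z : cdisc z -> disc z \/ circle z.
Proof.
by rewrite /cdisc /disc /circle /= le_eqVlt => /orP[/eqP|]; [right|left].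
Qed.

(** The circle is infinite: it holds the points of abscissa 1, 1/2, 1/3, ... *)
Lemma poly_circle_eq0 f : (forall z, circle z -> f.[z] = 0) -> f = 0.
Proof.
move=> f0; apply/eqP; apply: contraT => fN0.
pose y k : R := k.+1%:R^-1.
pose pt k : C := (y k +i* Num.sqrt (1 - y k ^+ 2))%C.
have ptc k : circle (pt k).
  have yk0 : 0 <= y k by rewrite invr_ge0 ler0n.
  have yk : y k <= 1 by rewrite invf_le1 ?ltr0n// ler1n.
  rewrite /circle /=; apply: etrans (normc_def _) _ => /=.
  by rewrite sqr_sqrtr ?subr_ge0 ?expr_le1// addrC subrK sqrtr1.
have pt_inj : injective pt.
  by move=> i j [] /invr_inj /eqP; rewrite eqr_nat => /eqP[].
have : (size [seq pt k | k <- iota 0 (size f)] < size f)%N.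
  apply: max_poly_roots => //; last by rewrite map_inj_uniq// iota_uniq.
  by apply/allP => z /mapP[k _ ->]; apply/eqP; exact: f0.
by rewrite size_map size_iota ltnn.
Qed.

Lemma poly_circle_inj f g : (forall z, circle z -> f.[z] = g.[z]) -> f = g.
Proof.
move=> fg; apply/eqP; rewrite -subr_eq0; apply/eqP/poly_circle_eq0 => z zc.
by rewrite hornerD hornerN fg// subrr.
Qed.

Lemma horner_reversal n f z : (size f <= n.+1)%N -> z != 0 ->
  (reversal n f).[z] = z ^+ n * (f.[(z^*)^-1])^*.
Proof.
move=> sf z0; rewrite horner_poly (horner_coef_wide _ sf) rmorph_sum mulr_sumr.
rewrite (reindex_inj rev_ord_inj) /=; apply: eq_bigr => i _.
have ilen : (i <= n)%N by rewrite -ltnS.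
rewrite subSS subKn// rmorphM rmorphXn fmorphV /= conjCK.
by rewrite exprVn mulrCA -expfB_cond// (negbTE z0) add0n.
Qed.

Lemma reversal_circle n f z : (size f <= n.+1)%N -> circle z ->
  (reversal n f).[z] = z ^+ n * (f.[z])^*.
Proof.
move=> sf zc; rewrite horner_reversal ?circle_neq0//.
by rewrite (circle_conj zc) invrK.
Qed.

Lemma reversal_of_real n G : (size G <= n.*2.+1)%N ->
  (forall z, circle z -> z ^- n * G.[z] \is Num.real) ->
  reversal n.*2 G = G.
Proof.
move=> sG Gr; apply: poly_circle_inj => z zc; have z0 := circle_neq0 zc.
rewrite reversal_circle//; have /CrealP/= := Gr z zc.
rewrite rmorphM fmorphV rmorphXn /= (circle_conj zc) exprVn invrK.
by rewrite -addnn exprD -mulrA => ->; rewrite mulrA divff ?mul1r// expf_neq0.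
Qed.

Definition self_reversive n f := (size f <= n.+1)%N /\ reversal n f = f.

Lemma self_reversiveP n f : (size f <= n.+1)%N ->
  (forall z, circle z -> f.[z] = z ^+ n * (f.[z])^*) -> self_reversive n f.
Proof.
move=> sf fE; split=> //; apply: poly_circle_inj => z zc.
by rewrite reversal_circle// -fE.
Qed.

Lemma self_reversive_circle n f z : self_reversive n f -> circle z ->
  f.[z] = z ^+ n * (f.[z])^*.
Proof. by case=> sf rf zc; rewrite -(reversal_circle sf zc) rf. Qed.

Lemma self_reversive1 : self_reversive 0 1.
Proof.
apply: self_reversiveP => [|z zc]; first by rewrite size_poly1.
by rewrite hornerC conjC1 mulr1.
Qed.

Lemma self_reversiveM m n f g : self_reversive m f -> self_reversive n g ->
  self_reversive (m + n) (f * g).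
Proof.
move=> hf hg; apply: self_reversiveP => [|z zc].
  apply: leq_trans (size_polyMleq _ _) _.
  by case: hf hg => [sf _] [sg _]; lia.
rewrite hornerM {1}(self_reversive_circle hf zc).
by rewrite {1}(self_reversive_circle hg zc) rmorphM exprD; ring.
Qed.

Lemma self_reversiveZ n (c : R) f : self_reversive n f ->
  self_reversive n (rc c *: f).
Proof.
move=> hf; apply: self_reversiveP => [|z zc].
  by apply: leq_trans (size_scale_leq _ _) _; case: hf.
by rewrite hornerZ {1}(self_reversive_circle hf zc) rmorphM /= rc_conj; ring.
Qed.

Lemma size_1subZX a : (size (1 - a *: 'X : {poly C})%R <= 2)%N.
Proof.
rewrite (leq_trans (size_polyD _ _))// geq_max size_poly1 size_polyN.
by rewrite (leq_trans (size_scale_leq _ _))// size_polyX.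
Qed.

(** Its zeros [a] and [1 / a^*] are exchanged by reflection in the circle, where
    it equals z |z - a|^2; products of such pairs are thus the simplest
    nonnegative trigonometric polynomials. *)
Definition blaschke_pair a : {poly C} := ('X - a%:P) * (1 - a^* *: 'X).

Lemma blaschke_pair_circle a z : circle z ->
  (blaschke_pair a).[z] = z * `|z - a| ^+ 2.
Proof.
move=> zc; have z0 := circle_neq0 zc.
rewrite /blaschke_pair hornerM hornerXsubC hornerD hornerN hornerZ hornerX hornerC.
by rewrite normCK rmorphB /= (circle_conj zc); field.
Qed.

Lemma blaschke_pairE a : a != 0 ->
  blaschke_pair a = (- a^*) *: (('X - a%:P) * ('X - ((a^*)^-1)%:P)).
Proof.
rewrite -conjC_eq0 => a0; rewrite scalerAr; congr (_ * _).
rewrite scalerBr -!mul_polyC -polyCM mulNr divff// !polyCN polyC1 opprK mulNr.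
by rewrite addrC.
Qed.

Lemma blaschke_pair_neq0 a : blaschke_pair a != 0.
Proof.
rewrite mulf_neq0 ?polyXsubC_eq0//.
apply/eqP => /(congr1 (fun f : {poly C} => f.[0])).
rewrite hornerD hornerN hornerZ hornerX mulr0 subr0 hornerC horner0.
by move=> /eqP; rewrite oner_eq0.
Qed.

Lemma self_reversive_blaschke_pair a : self_reversive 2 (blaschke_pair a).
Proof.
apply: self_reversiveP => [|z zc].
  apply: leq_trans (size_polyMleq _ _) _.
  by rewrite size_XsubC; have := size_1subZX a^*; lia.
rewrite blaschke_pair_circle// rmorphM rmorphXn /= (CrealP (normr_real _)).
by rewrite (circle_conj zc) expr2 mulrA mulfK// circle_neq0.
Qed.

Lemma self_reversive_blaschke_prod s :
  self_reversive (size s).*2 (\prod_(a <- s) blaschke_pair a).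
Proof.
elim: s => [|a s IH]; first by rewrite big_nil; exact: self_reversive1.
rewrite big_cons /= doubleS -add2n.
by apply: self_reversiveM => //; exact: self_reversive_blaschke_pair.
Qed.

(** * Fejer-Riesz factorisation *)

(** A polynomial that is real on the circle up to z^-n is symmetric under
    reversal.  By induction on n: a nonzero root of G does not lie on the circle
    and its reflection is another root; the one of the two outside the closed
    disc goes into D, and the pair contributes the positive factor |z - b|^2 on
    the circle, so that the quotient is of the same kind.  If 0 is a root of G,
    then by symmetry the top coefficient vanishes as well, and dividing by 'X
    lowers n. *)
Lemma fejer_riesz_pos n G : (size G <= n.*2.+1)%N ->
  (forall z, circle z -> 0 < z ^- n * G.[z]) ->
  exists D, [/\ (size D <= n.+1)%N, forall z, cdisc z -> D.[z] != 0 &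
    forall z, circle z -> z ^- n * G.[z] = `|D.[z]| ^+ 2].
Proof.
elim: n G => [|n IHn] G sG Gpos.
  have GC : G = (G`_0)%:P by apply: size1_polyC.
  move: Gpos; rewrite GC; set g := G`_0 => Gpos.
  have g0 : 0 < g.
    by have := Gpos 1; rewrite /circle /= normr1 expr0 invr1 mul1r hornerC; exact.
  exists (sqrtC g)%:P; split; first by rewrite size_polyC; case: eqP.
    by move=> z _; rewrite hornerC sqrtC_eq0 gt_eqF.
  move=> z zc; rewrite !hornerC expr0 invr1 mul1r.
  by rewrite -normrX sqrtCK gtr0_norm.
have GN0 z : circle z -> G.[z] != 0.
  by move=> zc; apply: contraTneq (Gpos z zc) => ->; rewrite mulr0 ltxx.
have symG : reversal n.+1.*2 G = G.
  by apply: reversal_of_real => // z zc; apply/gtr0_real/Gpos.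
have topG : G`_n.+1.*2 = (G`_0)^*.
  by rewrite -[in LHS]symG coef_poly ltnSn subnn.
have [G00|G0N0] := eqVneq G`_0 0.
  have /factor_theorem[G1 GE] : root G 0 by rewrite /root horner_coef0 G00.
  rewrite subr0 in GE.
  have G1E z : circle z -> z ^- n.+1 * G.[z] = z ^- n * G1.[z].
    move=> /circle_neq0 z0; rewrite GE hornerMX exprS; field.
    by rewrite z0 expf_neq0.
  have G1N0 : G1 != 0.
    apply/eqP => G10; have c1 : circle (1 : C) by rewrite /circle /= normr1.
    by have := GN0 1 c1; rewrite GE G10 mul0r horner0 eqxx.
  have [|z zc|D [sD DN0 DE]] := IHn G1; last first.
  - exists D; split=> [||z zc]//; first exact: leqW.
    by rewrite G1E// DE.
  - by rewrite -G1E// Gpos.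
  have : (size G <= n.+1.*2)%N.
    rewrite leqNgt; apply/negP => lts.
    have sGE : size G = n.+1.*2.+1 by apply/eqP; rewrite eqn_leq sG.
    have : lead_coef G = 0 by rewrite lead_coefE sGE /= topG G00 conjC0.
    move/eqP; rewrite lead_coef_eq0 => /eqP G0.
    by move: sGE; rewrite G0 size_poly0.
  by rewrite GE size_mulX// doubleS.
have [b b1 rb] : exists2 b, 1 < `|b| & root G b.
  have [a ra] : exists a, root G a.
    (* G is not constant: its top coefficient is conjugate to G`_0 *)
    apply/closed_rootP; rewrite neq_ltn; apply/orP; right.
    apply: leq_trans (_ : n.+1.*2.+1 <= _)%N => //; rewrite ltnNge.
    by apply: contra G0N0 => sG'; rewrite -conjC_eq0 -topG nth_default.
  have a0 : a != 0.
    apply: contraNneq G0N0 => a0; rewrite -horner_coef0.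
    by move: ra; rewrite a0.
  have aN1 : `|a| != 1.
    by apply/eqP => a1; move: ra; rewrite /root (negbTE (GN0 _ a1)).
  have [a1|a1] : 1 < `|a| \/ `|a| < 1.
    have /real_ltgtP : 1 \is @Num.real C by exact: real1.
    move=> /(_ `|a| (normr_real a)) []; auto.
    by move=> /esym/eqP; rewrite (negbTE aN1).
  - by exists a.
  exists (a^*)^-1.
    by rewrite normfV norm_conjC invf_gt1 ?normr_gt0.
  move: ra; rewrite /root -[in X in X -> _]symG horner_reversal//.
  by rewrite mulf_eq0 expf_eq0 (negbTE a0) andbF conjC_eq0.
have b0 : b != 0 by rewrite -normr_gt0 (lt_trans ltr01).
have bJ0 : b^* != 0 by rewrite conjC_eq0.
have rb' : root G (b^*)^-1.
  move: rb; rewrite /root -[in X in X -> _]symG horner_reversal//.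
  by rewrite mulf_eq0 expf_eq0 (negbTE b0) andbF conjC_eq0.
have bb' : (b^*)^-1 != b.
  apply/eqP => e; have := b1; have := congr1 Num.norm e.
  rewrite normfV norm_conjC => {}e.
  by rewrite -invf_lt1 ?normr_gt0// e => /(lt_trans b1); rewrite ltxx.
have [G1 GE] : exists G1, G = blaschke_pair b * G1.
  have /factor_theorem[H HE] := rb.
  move: rb'; rewrite HE rootM root_XsubC (negbTE bb') orbF.
  move=> /factor_theorem[H' ->].
  exists (- (b^*)^-1 *: H').
  rewrite blaschke_pairE// -scalerAr -scalerAl scalerA mulrNN mulVf// scale1r.
  by rewrite [RHS]mulrC mulrA mulrAC.
have c1 : circle (1 : C) by rewrite /circle /= normr1.
have facE z : circle z -> z ^- n.+1 * G.[z] = `|z - b| ^+ 2 * (z ^- n * G1.[z]).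
  move=> zc; have z0 := circle_neq0 zc.
  rewrite GE hornerM blaschke_pair_circle// exprS; field.
  by rewrite z0 expf_neq0.
have zb0 z : cdisc z -> z - b != 0.
  rewrite subr_eq0; apply: contraTneq => ->; rewrite /cdisc /=.
  by rewrite lt_geF.
have [|z zc|D [sD DN0 DE]] := IHn G1; last first.
- exists (('X - b%:P) * D); split.
  + apply: (leq_trans (size_polyMleq _ _)).
    by rewrite size_XsubC.
  + by move=> z zc; rewrite !hornerE mulf_neq0// ?DN0// zb0.
  + by move=> z zc; rewrite facE// (DE z zc) hornerM normrM exprMn hornerXsubC.
- have := Gpos z zc; rewrite facE// pmulr_rgt0//.
  by rewrite exprn_gt0// normr_gt0 zb0//; exact: circle_cdisc.
have G1N0 : G1 != 0.
  apply/eqP => G10.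
  by have := GN0 1 c1; rewrite GE G10 mulr0 horner0 eqxx.
move: sG; rewrite GE blaschke_pairE// -scalerAl size_scale ?oppr_eq0//.
rewrite -mulrA !size_mul ?mulf_neq0 ?polyXsubC_eq0// !size_XsubC.
by rewrite !doubleS !add2n.
Qed.

(** * Continuity and compactness in the complex plane *)

Lemma rc_continuous : continuous (rc : R -> C).
Proof.
move=> x; apply/cvgrPdist_lt => e e0.
have [d eE] := realE (gtr0_real e0).
near=> y; rewrite -rcB norm_rc eE; apply: (etrans (ltcR _ _)).
near: y; apply: cvgr_dist_lt => //.
by move: e0; rewrite eE rc_gt0.
Unshelve. all: by end_near. Qed.

Lemma conj_continuous : continuous (Num.conj : C -> C).
Proof.
move=> x; have F : Filter (nbhs (x : C)) by exact: nbhs_filter.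
apply/(@cvgrPdist_lt _ C _ _ F) => e e0.
by exists e => // y /=; rewrite -rmorphB norm_conjC.
Qed.

Lemma hornerC_continuous f : continuous (horner f : C -> C).
Proof.
elim/poly_ind: f => [|f c IH] x.
  have -> : horner 0 = fun=> 0 :> C by apply/funext => y; rewrite horner0.
  exact: cst_continuous.
have -> : horner (f * 'X + c%:P) = fun y : C => f.[y] * y + c.
  by apply/funext => y; rewrite hornerMXaddC.
apply: (@continuousD _ _ _ (fun y : C => f.[y] * y) (fun=> c)).
  by apply: continuousM; [exact: IH|exact: cvg_id].
exact: cst_continuous.
Qed.

Lemma expiE (x : R) : expi x = rc (cos x) + 'i * rc (sin x).
Proof.
by rewrite /expi /rc -complexiE; simpc.
Qed.

Lemma expi_continuous : continuous (expi : R -> C).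
Proof.
move=> x; have -> : expi = fun y : R => rc (cos y) + 'i * rc (sin y).
  by apply/funext => y; exact: expiE.
apply: (@continuousD _ _ _ (fun y => rc (cos y)) (fun y => 'i * rc (sin y))).
  by apply: continuous_comp; [exact: continuous_cos|exact: rc_continuous].
apply: continuousM; first exact: cst_continuous.
by apply: continuous_comp; [exact: continuous_sin|exact: rc_continuous].
Qed.

Lemma circle_expi (x : R) : circle (expi x).
Proof.
rewrite /circle /=; apply: etrans (normc_def _) _ => /=.
by rewrite cos2Dsin2 sqrtr1.
Qed.

(** The argument is [acos] of the real part on the upper half circle, and
    2 pi minus it on the lower one. *)
Lemma circle_argument z : circle z ->
  exists2 x : R, 0 <= x < 2 * pi & z = expi x.
Proof.
case: z => a b z1; have ab : a ^+ 2 + b ^+ 2 = 1.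
  have := add_Re2_Im2 (a +i* b)%C; rewrite /= (_ : `|_| = 1)//= expr1n.
  by move=> /complexI.
have a1 : -1 <= a <= 1.
  have a2 : a ^+ 2 <= 1 by rewrite -ab lerDl sqr_ge0.
  by apply/andP; split; nra.
have ai : a \in `[-1, 1] by rewrite in_itv.
have sE : Num.sqrt (1 - a ^+ 2) = `|b|.
  by rewrite -sqrtr_sqr -ab addrC addKr.
have acge : 0 <= acos a by rewrite acos_ge0.
have acle : acos a <= pi by rewrite acos_lepi.
have pi0 := pi_gt0 R.
have [b0|b0] := leP 0 b.
  exists (acos a).
    rewrite acge /=; apply: le_lt_trans acle _.
    by rewrite mulr_natl mulr2n ltrDl.
  by rewrite /expi acosK// sin_acos// sE ger0_norm.
exists (2 * pi - acos a); last first.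
  rewrite /expi addrC mulr_natl.
  rewrite cosD2pi sinD2pi cosN sinN acosK// sin_acos//.
  by rewrite sE ltr0_norm// opprK.
rewrite subr_ge0 ltrBlDr ltrDl; apply/andP; split.
  apply: le_trans acle _.
  by rewrite mulr_natl mulr2n lerDl ltW.
rewrite lt_neqAle acge andbT; apply/eqP => a0.
move: b0; have := ab; rewrite -(acosK ai) -a0 cos0 expr1n => /eqP.
by rewrite addrC -subr_eq0 addrK sqrf_eq0 => /eqP->; rewrite ltxx.
Qed.

(** The closed disc is the image of a rectangle under polar coordinates. *)
Lemma cdisc_compact : compact (cdisc : set C).
Proof.
pose polar (x : R * R) : C := rc x.1 * expi x.2.
have -> : cdisc = polar @` (`[0, 1] `*` `[0, 2 * pi]).
  apply/seteqP; split => [z zd|_ [[r x] [/= r01 _] <-]].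
    have [r rE] := realE (normr_real z).
    have r0 : 0 <= r by rewrite -rc_ge0 -rE.
    have r1 : r <= 1 by rewrite -rc_le1 -rE.
    have [z0|z0] := eqVneq z 0.
      exists (0, 0); last by rewrite /polar /= rc0 mul0r z0.
      by split; rewrite /= in_itv /= lexx ?ler01// mulr_ge0// pi_ge0.
    have [|x xi xE] := @circle_argument (z / `|z|).
      by rewrite /circle /= normrM normfV normr_id divff// normr_eq0.
    exists (r, x); last first.
      by rewrite /polar /= -rE -xE mulrC divfK// normr_eq0.
    split; rewrite /= in_itv /= ?r0//.
    by case/andP: xi => -> /ltW ->.
  rewrite /cdisc /= /polar normrM (circle_expi x) mulr1 norm_rc /=.
  by move: r01; rewrite in_itv /= => /andP[r0 r1]; rewrite ger0_norm// rc_le1.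
apply: continuous_compact; last by apply: compact_setX; exact: segment_compact.
apply: continuous_subspaceT => x.
apply: (@continuousM _ _ (fun x : R * R => rc x.1) (fun x => expi x.2)).
  by apply: continuous_comp; [exact: cvg_fst|exact: rc_continuous].
by apply: continuous_comp; [exact: cvg_snd|exact: expi_continuous].
Qed.

Lemma rcRe_norm (z : C) : rc (complex.Re `|z|) = `|z|.
Proof. by have [r ->] := realE (normr_real z). Qed.

Lemma Re_continuous : continuous (@complex.Re R : C -> R).
Proof.
move=> x; have F : Filter (nbhs (x : C)) by exact: nbhs_filter.
apply/(@cvgrPdist_lt _ _ _ _ F) => e e0.
have e0' : 0 < rc e :> C by rewrite rc_gt0.
exists (rc e) => // y; rewrite /ball_ /= => xye.
rewrite -(raddfB (@complex.Re R)).
rewrite -ltcR; apply: le_lt_trans xye.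
exact: normc_ge_Re.
Qed.

Lemma continuous_quotient E D z : D.[z] != 0 ->
  {for z, continuous (fun z : C => E.[z] / D.[z])}.
Proof.
move=> Dz; apply: (@continuousM _ _ (horner E) (fun z => (D.[z])^-1)).
  exact: hornerC_continuous.
by apply: continuousV => //; exact: hornerC_continuous.
Qed.

Lemma continuous_pair (X U V : topologicalType) (f : X -> U) (g : X -> V)
    (x : X) :
  {for x, continuous f} -> {for x, continuous g} ->
  {for x, continuous (fun y => (f y, g y))}.
Proof. by move=> cf cg; exact: cvg_pair. Qed.

Lemma rc1B_continuous : continuous (fun u : R => rc (1 - u) : C).
Proof.
move=> u.
apply: (@continuous_comp _ _ _ (fun u : R => 1 - u) (@rc R)).
  by apply: (@continuousB R R R (fun=> 1) id);
    [exact: cst_continuous|exact: cvg_id].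
exact: rc_continuous.
Qed.

(** * The maximum modulus principle for rational functions *)

(** If E / D exceeds 1 in modulus, its maximum over the compact disc is attained
    at an interior point z0.  With c the value there, E - c D has a zero at z0 of
    some finite order m, so that E / D = c + (z - z0)^m g(z) with g(z0) != 0.
    Moving away from z0 in a direction u for which u^m g(z0) = c multiplies c by
    about 1 + e^m, which increases the modulus. *)
Lemma maximum_modulus E D : (forall z, cdisc z -> D.[z] != 0) ->
  (forall z, circle z -> `|E.[z]| <= `|D.[z]|) ->
  forall z, cdisc z -> `|E.[z]| <= `|D.[z]|.
Proof.
move=> D0 ED z1 z1d; rewrite real_leNgt ?normr_real//; apply/negP => DE1.
pose f (z : C) : R := complex.Re `|E.[z] / D.[z]|.
have fE z : rc (f z) = `|E.[z] / D.[z]| by exact: rcRe_norm.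
have [||z0 /set_mem z0d z0max] :=
  compact_EVT_max _ cdisc_compact (_ : {within cdisc, continuous f}).
- by exists z1.
- apply: continuous_in_subspaceT => z /set_mem zd.
  apply: (@continuous_comp _ _ _ (fun z => `|E.[z] / D.[z]| : C)); last first.
    exact: Re_continuous.
  apply: (@continuous_comp _ _ _ (fun z => E.[z] / D.[z])); last first.
    exact: norm_continuous.
  by apply: continuous_quotient; exact: D0.
pose c := E.[z0] / D.[z0].
have {}z0max z : cdisc z -> `|E.[z] / D.[z]| <= `|c|.
  move=> zd; rewrite -!fE; apply: (etrans (lecR _ _)).
  by apply: z0max; exact/mem_set.
have c1 : 1 < `|c|.
  apply: lt_le_trans (z0max _ z1d).
  by rewrite normrM normfV ltr_pdivlMr ?mul1r// normr_gt0 D0.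
have z0D : disc z0.
  case: (cdiscP z0d) => // z0c; move: c1.
  rewrite /c normrM normfV ltr_pdivlMr ?normr_gt0 ?D0// mul1r.
  by move=> /(le_lt_trans (ED _ z0c)); rewrite ltxx.
pose Q := E - c *: D.
have QE z : D.[z] != 0 -> E.[z] / D.[z] = c + Q.[z] / D.[z].
  by move=> Dz; rewrite !hornerE; field.
(* otherwise |E| = |c| |D| > |D| at the point 1 of the circle *)
have Q0 : Q != 0.
  apply/eqP => Q0; have cc : circle (1 : C) by rewrite /circle /= normr1.
  have D1 : D.[1] != 0 by apply/D0/circle_cdisc.
  have := QE 1 D1; rewrite Q0 horner0 mul0r addr0 => e.
  move: c1; rewrite -e normrM normfV ltr_pdivlMr ?normr_gt0// mul1r.
  by move=> /(le_lt_trans (ED _ cc)); rewrite ltxx.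
have Dz0 : D.[z0] != 0 := D0 _ z0d.
have [m [q + qE]] := multiplicity_XsubC Q z0; rewrite Q0 /= => qz0.
have m0 : (0 < m)%N.
  rewrite lt0n; apply/eqP => m0; move: qz0.
  have -> : q = Q by rewrite qE m0 expr0 mulr1.
  by rewrite /root /Q !hornerE /c divfK// subrr eqxx.
pose u := m.-root (c * D.[z0] / q.[z0]).
have uE : u ^+ m = c * D.[z0] / q.[z0] by rewrite rootCK.
pose G (e : R) : C := u ^+ m * (q.[z0 + rc e * u] / D.[z0 + rc e * u]).
have G0 : G 0 = c.
  rewrite /G rc0 mul0r addr0 uE; field.
  by rewrite Dz0; exact: qz0.
have Gcont : {for 0, continuous G}.
  apply: continuousM; first exact: cst_continuous.
  apply: (@continuous_comp _ _ _ (fun e : R => z0 + rc e * u)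
                                 (fun z => q.[z] / D.[z])).
    apply: (@continuousD _ _ _ (fun=> z0) (fun e : R => rc e * u)).
      exact: cst_continuous.
    apply: continuousM; [exact: rc_continuous|exact: cst_continuous].
  by apply: continuous_quotient; rewrite rc0 mul0r addr0.
have c0 : 0 < `|c| := lt_trans ltr01 c1.
have near1 : \forall e \near 0^'+, `|G e - c| < `|c|.
  have GG : G e @[e --> 0^'+] --> c.
    by rewrite -G0; apply: cvg_at_right_filter; exact: Gcont.
  exact: (cvgr_distC_lt _ _ GG _ c0).
have [a aE] := realE (normr_real z0).
have [b bE] := realE (normr_real u).
have a1 : a < 1 by move: z0D; rewrite /disc /= aE rc_lt1.
have b0 : 0 <= b by rewrite -rc_ge0 -bE.
have near2 : \forall e \near 0^'+, e < (1 - a) / (b + 1).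
  by apply: nbhs_right_lt; rewrite divr_gt0 ?subr_gt0// ltr_wpDl.
near (0 : R)^'+ => e.
have e0 : 0 < e by [].
have Ge : `|G e - c| < `|c| by near: e.
have eab : e < (1 - a) / (b + 1) by near: e.
have zd : cdisc (z0 + rc e * u).
  rewrite /cdisc /=; apply: le_trans (ler_normD _ _) _.
  rewrite normrM aE bE norm_rc -rcM -rcD rc_le1 gtr0_norm//.
  have b1 : 0 < b + 1 by rewrite ltr_wpDl.
  by move: eab; rewrite ltr_pdivlMr//; nra.
have := z0max _ zd; rewrite QE ?D0//; apply/negP.
rewrite -real_ltNge ?normr_real//.
rewrite qE hornerM horner_exp hornerXsubC addrAC subrr add0r exprMn.
set em := rc e ^+ m; have em0 : 0 < em by rewrite exprn_gt0// rc_gt0.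
have -> : c + q.[z0 + rc e * u] * (em * u ^+ m) / D.[z0 + rc e * u] =
    (1 + em) * c - em * (c - G e).
  by rewrite /G; ring.
apply: lt_le_trans (lerB_dist _ _).
rewrite !normrM (gtr0_norm em0) (gtr0_norm (addr_gt0 ltr01 em0)) distrC.
rewrite mulrDl mul1r -addrA ltrDl subr_gt0.
by rewrite ltr_pM2l// -normrM.
Unshelve. all: by end_near. Qed.

(** * Blaschke products and the symmetrised bidisc *)

Lemma reversal_XsubC_mul n a f : (size f <= n.+1)%N ->
  reversal n.+1 (('X - a%:P) * f) = (1 - a^* *: 'X) * reversal n f.
Proof.
move=> sf; apply: poly_circle_inj => z zc; have z0 := circle_neq0 zc.
have sg : (size (('X - a%:P) * f)%R <= n.+2)%N.
  by apply: (leq_trans (size_polyMleq _ _)); rewrite size_XsubC.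
rewrite reversal_circle// !hornerM (reversal_circle sf zc) hornerXsubC.
rewrite hornerD hornerN hornerZ hornerX hornerC rmorphM rmorphB /= circle_conj//.
by rewrite exprS; field.
Qed.

Lemma norm_blaschke_factor (a z : C) : disc z -> 1 < `|a| ->
  `|1 - a^* * z| < `|z - a|.
Proof.
move=> zd a1; rewrite -(@ltr_pXn2r _ 2)// ?nnegrE// -subr_gt0 !normCK.
rewrite !rmorphB !rmorphM rmorph1 /= conjCK.
have -> : (z - a) * (z^* - a^*) - (1 - a^* * z) * (1 - a * z^*)
   = (1 - z * z^*) * (a * a^* - 1) by ring.
rewrite -!normCK mulr_gt0// subr_gt0; first by rewrite expr_lt1.
by rewrite exprn_egt1.
Qed.

(** The quotient of the reversal of D by D is a unimodular multiple of z^k times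
    Blaschke factors (1 - a^* z) / (z - a), each less than 1 in modulus in the
    disc; their total number is n, so that there is at least one. *)
Lemma reversal_lt n D z : (0 < n)%N -> (size D <= n.+1)%N ->
  (forall w, cdisc w -> D.[w] != 0) -> disc z ->
  `|(reversal n D).[z]| < `|D.[z]|.
Proof.
move=> n0 sD D0 zd.
have D00 : D != 0.
  by apply: contraNneq (D0 z (disc_cdisc zd)) => ->; rewrite horner0.
have [rs DE] := closed_field_poly_normal D.
move: sD; rewrite DE; set c := lead_coef D => sD.
have c0 : c != 0 by rewrite lead_coef_eq0.
have rs1 a : a \in rs -> 1 < `|a|.
  move=> ars; rewrite real_ltNge ?normr_real ?real1//.
  apply/negP => /D0 /negP; apply; rewrite DE hornerZ mulf_eq0 (negbTE c0) /=.
  by have := root_prod_XsubC rs a; rewrite ars.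
have {}sD : (size rs <= n)%N by move: sD; rewrite size_scale// size_prod_XsubC.
(* the weak inequality, true for n = 0 as well, carries the induction *)
suff [_ /(_ n0)//] : `|(reversal n (c *: \prod_(a <- rs) ('X - a%:P))).[z]| <=
    `|(c *: \prod_(a <- rs) ('X - a%:P)).[z]| /\
  ((0 < n)%N -> `|(reversal n (c *: \prod_(a <- rs) ('X - a%:P))).[z]| <
    `|(c *: \prod_(a <- rs) ('X - a%:P)).[z]|).
elim: rs n {n0 DE} rs1 sD => [|a rs IH] n rs1 sn.
  have -> : reversal n (c *: \prod_(a <- [::]) ('X - a%:P)) = c^* *: 'X^n.
    rewrite big_nil; apply: poly_circle_inj => w wc.
    by rewrite reversal_circle ?size_scale ?size_poly1// !hornerE mulrC.
  rewrite big_nil !hornerE normrM norm_conjC normrX; split.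
    by rewrite ler_piMr// exprn_ile1// ltW.
  by move=> n0; rewrite gtr_pMr ?normr_gt0// exprn_ilt1// -lt0n.
case: n sn => // n sn.
rewrite big_cons scalerAr reversal_XsubC_mul; last first.
  by rewrite size_scale// size_prod_XsubC.
have [|//|le _] := IH n; first by move=> b brs; apply: rs1; rewrite inE brs orbT.
have a1 : 1 < `|a| by apply: rs1; rewrite mem_head.
suff lt : `|((1 - a^* *: 'X) * reversal n (c *: \prod_(j <- rs) ('X - j%:P))).[z]| <
          `|(('X - a%:P) * (c *: \prod_(j <- rs) ('X - j%:P))).[z]|.
  by split=> [|_] //; exact: ltW.
rewrite hornerM normrM [in ltRHS]hornerM normrM.
rewrite hornerXsubC hornerD hornerN hornerZ hornerX hornerC.
apply: le_lt_trans (_ : _ <= `|1 - a^* * z| *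
                             `|(c *: \prod_(j <- rs) ('X - j%:P)).[z]|) _.
  by rewrite ler_wpM2l.
rewrite ltr_pM2r ?norm_blaschke_factor// normr_gt0 hornerZ mulf_neq0//.
have := root_prod_XsubC rs z; rewrite /root => ->.
apply/negP => zrs; have := rs1 z; rewrite inE zrs orbT => /(_ isT).
by move=> /lt_trans-/(_ _ zd); rewrite ltxx.
Qed.

(** If a = |x| were at least 1, the rotation w making w x = a would give
    |(2 a - 1) v - a| < |2 - a - v| for v = w y.  The difference of the squares
    is 4 (a - 1) (a |v|^2 - (a + 1) Re v + 1), and the last factor is at least
    (1 - a |v|) (1 - |v|), which is nonnegative as a |v| = |x y| <= 1. *)
Lemma symbidisc_root (x y : C) : `|x * y| <= 1 ->
  (forall w : C, circle w ->
     `|2 * w * (x * y) - (x + y)| < `|2 - w * (x + y)|) ->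
  `|x| < 1.
Proof.
move=> xy1 H; rewrite real_ltNge ?normr_real ?real1//; apply/negP => x1.
have nx0 : 0 < `|x| := lt_le_trans ltr01 x1.
pose w := x^* / `|x|.
have wc : circle w.
  by rewrite /circle /= normrM normfV norm_conjC normr_id divff ?gt_eqF.
have wx : w * x = `|x|.
  by rewrite /w mulrAC [_ * x]mulrC -normCK expr2 mulfK ?gt_eqF.
have [v vE] : exists v, v = w * y by exists (w * y).
have nv : `|x| * `|v| <= 1 by rewrite vE normrM wc mul1r -normrM.
have := H w wc.
have -> : `|2 * w * (x * y) - (x + y)| = `|2 * (w * x) * v - (w * x) - v|.
  by rewrite -[LHS]mul1r -wc -normrM vE; congr (`|_|); ring.
have -> : 2 - w * (x + y) = 2 - w * x - v by rewrite vE; ring.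
rewrite {}wx.
have [a aE] := realE (normr_real x).
have [b bE] := realE (normr_real v).
have [t tE] : exists t : R, v + v^* = rc (2 * t).
  have [t0 t0E] : exists t0 : R, v + v^* = rc t0.
    by apply: realE; apply/CrealP; rewrite rmorphD /= conjCK addrC.
  by exists (t0 / 2); rewrite t0E mulrC divfK// pnatr_eq0.
have tb : t <= b.
  have : `|v + v^*| <= `|v| + `|v^*| := ler_normD _ _.
  rewrite norm_conjC tE bE norm_rc -rcD => /(le_trans _)-/(_ (rc (2 * t))).
  move=> /(_ _)/wrap[]; first by apply: (etrans (lecR _ _)); rewrite ler_norm.
  move=> h; have : 2 * t <= b + b by rewrite -(lecR).
  lra.
rewrite -(@ltr_pXn2r _ 2)// ?nnegrE// -subr_gt0 !normCK aE.
rewrite !rmorphB !rmorphM /= rc_conj conjC_nat.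
have -> : (2 - rc a - v) * (2 - rc a - v^*) -
    (2 * rc a * v - rc a - v) * (2 * rc a * v^* - rc a - v^*) =
    - (4 * (rc a - 1) * (rc a * (v * v^*) - (rc a + 1) * ((v + v^*) / 2) + 1)).
  by field; rewrite ?pnatr_eq0.
have a1 : 1 <= a by rewrite -(lecR); rewrite aE in x1.
have b0 : 0 <= b by rewrite -rc_ge0 -bE.
have ab1 : a * b <= 1 by move: nv; rewrite aE bE -rcM rc_le1.
have -> :
    - (4 * (rc a - 1) * (rc a * (v * v^*) - (rc a + 1) * ((v + v^*) / 2) + 1)) =
    rc (- (4 * (a - 1) * (a * b ^+ 2 - (a + 1) * t + 1))).
  rewrite -normCK bE tE.
  have -> : rc (2 * t) / 2 = rc t.
    have rc2 : rc 2 = 2 :> C by exact: (rmorph_nat (real_complex R) 2).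
    by rewrite mulrC rcM rc2 mulKf// pnatr_eq0.
  by rewrite /rc !(rmorphN, rmorphM, rmorphB, rmorphD, rmorphXn, rmorph1, rmorph_nat).
rewrite rc_gt0; apply/negP; rewrite -leNgt oppr_le0.
apply: mulr_ge0; first lra.
have : 0 <= (1 - a * b) * (1 - b) by apply: mulr_ge0; nra.
nra.
Qed.

Lemma symbidisc_criterion (s p : C) : `|p| <= 1 ->
  (forall w : C, circle w -> `|2 * w * p - s| < `|2 - w * s|) ->
  symbidisc (s, p).
Proof.
move=> p1 H.
pose d := sqrtC (s ^+ 2 - 4 * p).
have dE : d ^+ 2 = s ^+ 2 - 4 * p by rewrite sqrtCK.
pose x := (s + d) / 2; pose y := (s - d) / 2.
have sE : s = x + y by rewrite /x /y; field.
have pE : p = x * y.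
  have -> : x * y = (s ^+ 2 - d ^+ 2) / 4 by rewrite /x /y; field.
  by rewrite dE; field.
exists x.
  by apply: (@symbidisc_root x y); rewrite -?pE// => w; rewrite -sE; exact: H.
exists y.
  have [sE' pE'] : s = y + x /\ p = y * x by rewrite addrC mulrC.
  by apply: (@symbidisc_root y x); rewrite -?pE'// => w; rewrite -sE'; exact: H.
by rewrite -sE -pE.
Qed.

(** * Rational Gamma-inner functions from pairs of polynomials *)

(** The pairs (E, D) by which a rational Gamma-inner function of degree n is
    represented as (E / D, D~ / D), D~ being the reversal of D. *)
Definition inner_data n E D :=
  [/\ self_reversive n E, (size D <= n.+1)%N,
      forall z, cdisc z -> D.[z] != 0 &
      forall z, cdisc z -> `|E.[z]| <= 2 * `|D.[z]|].

Lemma inner_of_bGam n E D z : inner_data n E D -> circle z ->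
  bGam (inner_of n E D z).
Proof.
move=> hED zc; have [hE sD D0 ED] := hED; have zd := circle_cdisc zc.
have Dz := D0 _ zd; have DzJ : (D.[z])^* != 0 by rewrite conjC_eq0.
rewrite /bGam /inner_of /=; split.
- by rewrite normrM normfV ler_pdivrMr ?normr_gt0// ED.
- rewrite reversal_circle// !normrM normfV norm_conjC normrX.
  by rewrite (zc : `|z| = 1) expr1n mul1r divff// normr_eq0.
- rewrite reversal_circle// rmorphM fmorphV {1}(self_reversive_circle hE zc).
  by field; rewrite Dz DzJ.
Qed.

(** The factor r makes 2 D - w r E free of zeros in the closed disc for every
    unimodular w, although |E| = 2 |D| may occur on the circle. *)
Lemma inner_of_symbidisc n E D z (r : R) : (0 < n)%N -> inner_data n E D ->
  disc z -> 0 <= r < 1 ->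
  symbidisc (rc r * (inner_of n E D z).1, (inner_of n E D z).2).
Proof.
move=> n0 [hE sD D0 ED] zD /andP[r0 r1]; have zd := disc_cdisc zD.
have Dz := D0 _ zd.
apply: symbidisc_criterion.
  by rewrite /= normrM normfV ler_pdivrMr ?normr_gt0// mul1r ltW// reversal_lt.
move=> w wc; rewrite /inner_of /=.
pose M := 2 *: D - (w * rc r) *: E.
have sM : (size M <= n.+1)%N.
  rewrite (leq_trans (size_polyD _ _))// geq_max size_polyN.
  by rewrite !(leq_trans (size_scale_leq _ _))//; case: hE.
have MN0 u : cdisc u -> M.[u] != 0.
  move=> ud; rewrite !hornerE subr_eq0; apply/eqP => e.
  have : `|w * rc r * E.[u]| < 2 * `|D.[u]|.
    rewrite !normrM (wc : `|w| = 1) mul1r norm_rc (ger0_norm r0).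
    apply: le_lt_trans (_ : _ <= rc r * (2 * `|D.[u]|)) _.
      by rewrite ler_wpM2l ?rc_ge0// ED.
    by rewrite gtr_pMl ?rc_lt1// mulr_gt0// normr_gt0 D0.
  by rewrite -e normrM normr_nat ltxx.
have revM : reversal n M = 2 *: reversal n D - (w^* * rc r) *: E.
  apply: poly_circle_inj => u uc.
  have Eu := self_reversive_circle hE uc.
  rewrite reversal_circle// !hornerE reversal_circle// {2}Eu.
  by rewrite rmorphB !rmorphM /= rc_conj conjC_nat; ring.
have lt := reversal_lt n0 sM MN0 zD; rewrite revM !hornerE in lt.
have -> : 2 * w * ((reversal n D).[z] / D.[z]) - rc r * (E.[z] / D.[z]) =
    w * (2 * (reversal n D).[z] - w^* * rc r * E.[z]) / D.[z].
  rewrite (circle_conj wc); field.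
  by rewrite Dz circle_neq0.
have -> : 2 - w * (rc r * (E.[z] / D.[z])) =
    (2 * D.[z] - w * rc r * E.[z]) / D.[z] by field.
rewrite 2!normrM (wc : `|w| = 1) mul1r [ltRHS]normrM.
by rewrite ltr_pM2r// normfV invr_gt0 normr_gt0.
Qed.

Lemma inner_of_Gam n E D z : (0 < n)%N -> inner_data n E D -> disc z ->
  Gam (inner_of n E D z).
Proof.
move=> n0 hED zD B.
set h := inner_of n E D z => hB.
have ch : {for 1, continuous (fun r : R => (rc r * h.1, h.2))}.
  apply: continuous_pair; last exact: cst_continuous.
  apply: (@continuousM _ _ rc (fun=> h.1)); first exact: rc_continuous.
  exact: cst_continuous.
have hE : (rc 1 * h.1, h.2) = h by rewrite rc1 mul1r -surjective_pairing.
have nB : \forall r \near (1 : R)^'-, B (rc r * h.1, h.2).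
  by apply: (cvg_at_left_filter ch); rewrite /= hE.
near (1 : R)^'- => r.
exists (rc r * h.1, h.2); split; last by near: r.
apply: inner_of_symbidisc => //; apply/andP; split; last by [].
near: r; exact: nbhs_left_ge.
Unshelve. all: by end_near. Qed.

Lemma inner_of_continuous n E D z : D.[z] != 0 ->
  {for z, continuous (inner_of n E D)}.
Proof. by move=> Dz; apply: continuous_pair; exact: continuous_quotient. Qed.

Lemma inner_of_rational_Gamma_inner n E D : (0 < n)%N -> inner_data n E D ->
  rational_Gamma_inner (inner_of n E D).
Proof.
move=> n0 hED; have [_ _ D0 _] := hED; split.
- split; [exists E, D|exists (reversal n D), D] => z /disc_cdisc zd;
    by split=> //; exact: D0.
- by move=> z; exact: inner_of_Gam.
- apply: continuous_in_subspaceT => z /set_mem zd.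
  exact/inner_of_continuous/D0.
- by move=> z; exact: inner_of_bGam.
Qed.

(** * The degree *)

Lemma nonzero_segment (m : C) (u : R) : m != 0 -> 0 <= u <= 1 ->
  0 <= complex.Re m -> rc (1 - u) + rc u * m != 0.
Proof.
case: m => a b m0 /andP[u0 u1] /= a0; apply/eqP.
move=> /eqP; rewrite /rc; simpc; rewrite eq_complex /= => /andP[/eqP e1 /eqP e2].
have u1E : u = 1 by nra.
move: e1 e2 m0; rewrite u1E subrr add0r !mul1r => -> ->.
by rewrite eqxx.
Qed.

(** First [D] is contracted to its value at 0 along the radii.  At the same time
    it is multiplied by a factor that moves on a segment from 1 to [D.[0]^*] or
    to its opposite, whichever has nonnegative real part: such a segment avoids
    0, and the final product is real. *)
Lemma contraction_to_real_constant D : (forall z, cdisc z -> D.[z] != 0) ->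
  exists (q : R * C -> C) (c : C),
    [/\ continuous q,
        forall x, 0 <= x.1 <= 1 -> circle x.2 -> q x != 0,
        forall z, q (0, z) = D.[z],
        c \is Num.real & forall z, q (1, z) = c].
Proof.
move=> D0; have d0 : cdisc (0 : C) by rewrite /cdisc /= normr0.
have [m [mD m0 mre]] : exists m : C,
    [/\ m * D.[0] \is Num.real, m != 0 & 0 <= complex.Re m].
  have DJ : (D.[0])^* * D.[0] \is Num.real.
    by rewrite mulrC -normCK rpredX// normr_real.
  have [le|/ltW le] := leP 0 (complex.Re (D.[0])^*).
    by exists (D.[0])^*; rewrite conjC_eq0 D0.
  exists (- (D.[0])^*); split; rewrite ?oppr_eq0 ?conjC_eq0 ?D0//.
    by rewrite mulNr rpredN.
  by rewrite (raddfN (@complex.Re R)) oppr_ge0.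
exists (fun x => D.[rc (1 - x.1) * x.2] * (rc (1 - x.1) + rc x.1 * m)), (m * D.[0]).
split=> //.
- move=> x.
  have c1 : {for x, continuous (fun x : R * C => rc (1 - x.1))}.
    apply: (@continuous_comp _ _ _ fst (fun u : R => rc (1 - u))).
      exact: cvg_fst.
    exact: rc1B_continuous.
  apply: (@continuousM _ _ (fun x : R * C => D.[rc (1 - x.1) * x.2])
                           (fun x => rc (1 - x.1) + rc x.1 * m)).
    apply: (@continuous_comp _ _ _ (fun x : R * C => rc (1 - x.1) * x.2)
                                   (horner D)).
      apply: (@continuousM _ _ (fun x : R * C => rc (1 - x.1)) snd).
        exact: c1.
      exact: cvg_snd.
    exact: hornerC_continuous.
  apply: (@continuousD _ _ _ (fun x : R * C => rc (1 - x.1))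
                             (fun x => rc x.1 * m)).
    exact: c1.
  apply: (@continuousM _ _ (fun x : R * C => rc x.1) (fun=> m)); last first.
    exact: cst_continuous.
  by apply: (@continuous_comp _ _ _ fst rc);
    [exact: cvg_fst|exact: rc_continuous].
- move=> x /andP[u0 u1] zc; rewrite mulf_neq0//; last first.
    by apply: nonzero_segment => //; apply/andP.
  apply: D0; rewrite /cdisc /= normrM (zc : `|x.2| = 1) mulr1 norm_rc rc_le1.
  by rewrite ger0_norm; lra.
- by move=> z /=; rewrite subr0 rc0 rc1 mul0r addr0 mulr1 mul1r.
- by move=> z /=; rewrite subrr rc0 rc1 mul0r add0r mul1r mulrC.
Qed.

(** Let q_u be the path from D to a real constant.  The loop z^n q_u^* / q_u runs
    from p to z^n.  For p of this form the relation s = s^* p says that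
    f = s q_u / |q_u| satisfies f = z^n f^*.  Hence f may be kept fixed while
    q_u moves, and only be multiplied by 1 - u: this makes the first component
    (1 - u) s (D / |D|) (|q_u| / q_u), whose modulus never exceeds |s|. *)
Lemma inner_of_degree n E D : inner_data n E D ->
  Gamma_degree (inner_of n E D) n.
Proof.
move=> hED; have [hE sD D0 ED] := hED; left.
have [q [c [contq qN0 q0 cR q1]]] := contraction_to_real_constant D0.
have c0 : c != 0.
  rewrite -(q1 1); apply: qN0; first by rewrite /= ler01 lexx.
  by rewrite /circle /= normr1.
pose H1 (x : R * C) : C :=
  rc (1 - x.1) * E.[x.2] * `|q x| / (q x * `|D.[x.2]|).
pose H2 (x : R * C) : C := x.2 ^+ n * (q x)^* / q x.
pose H (x : R * C) : C * C := (H1 x, H2 x).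
exists H; split.
- apply: continuous_in_subspaceT => x /set_mem [/= x1 x2].
  move: x1; rewrite /= in_itv /= => x1.
  have qx := qN0 x x1 x2.
  have Dx : D.[x.2] != 0 by apply/D0/circle_cdisc.
  have cE (f : {poly C}) : {for x, continuous (fun x : R * C => f.[x.2])}.
    by apply: (@continuous_comp _ _ _ snd (horner f));
      [exact: cvg_snd|exact: hornerC_continuous].
  apply: (@continuous_pair _ _ _ H1 H2).
    apply: (@continuousM _ _ (fun x : R * C => rc (1 - x.1) * E.[x.2] * `|q x|)
                             (fun x => (q x * `|D.[x.2]|)^-1)).
      apply: (@continuousM _ _ (fun x : R * C => rc (1 - x.1) * E.[x.2])
                               (fun x => `|q x|)).
        apply: (@continuousM _ _ (fun x : R * C => rc (1 - x.1))
                                 (fun x => E.[x.2])); last exact: cE.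
        apply: (@continuous_comp _ _ _ fst (fun u : R => rc (1 - u))).
          exact: cvg_fst.
        exact: rc1B_continuous.
      by apply: (@continuous_comp _ _ _ q (fun z => `|z|));
        [exact: contq|exact: norm_continuous].
    apply: continuousV; first by rewrite mulf_neq0// normr_eq0.
    apply: (@continuousM _ _ q (fun x => `|D.[x.2]|)); first exact: contq.
    by apply: (@continuous_comp _ _ _ (fun x : R * C => D.[x.2]) (fun z => `|z|));
      [exact: cE|exact: norm_continuous].
  apply: (@continuousM _ _ (fun x : R * C => x.2 ^+ n * (q x)^*) (fun x => (q x)^-1)).
    apply: (@continuousM _ _ (fun x : R * C => x.2 ^+ n) (fun x => (q x)^*)).
      have -> : (fun x : R * C => x.2 ^+ n) = (fun x => ('X^n).[x.2]).
        by apply/funext => y; rewrite hornerXn.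
      exact: cE.
    by apply: (@continuous_comp _ _ _ q Num.conj);
      [exact: contq|exact: conj_continuous].
  by apply: continuousV => //; exact: contq.
- move=> u z; rewrite in_itv /= => u01 zc.
  have qx := qN0 (u, z) u01 zc; have zd := circle_cdisc zc.
  have qJ : (q (u, z))^* != 0 by rewrite conjC_eq0.
  have Dz := D0 _ zd.
  have nq : `|q (u, z)| != 0 by rewrite normr_eq0.
  have nD : `|D.[z]| != 0 by rewrite normr_eq0.
  rewrite /bGam /H /H1 /H2 /=; split.
  + rewrite !normrM normfV normrM !normr_id.
    have -> : `|rc (1 - u)| * `|E.[z]| * `|q (u, z)| / (`|q (u, z)| * `|D.[z]|) =
       `|rc (1 - u)| * (`|E.[z]| / `|D.[z]|) by field; rewrite nq nD.
    case/andP: u01 => u0 u1.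
    have uc : `|rc (1 - u)| <= 1 :> C by rewrite norm_rc rc_le1 ger0_norm; lra.
    apply: le_trans (ler_piMl _ uc) _; first by rewrite divr_ge0.
    by rewrite ler_pdivrMr ?normr_gt0// ED.
  + rewrite !normrM normfV norm_conjC normrX (zc : `|z| = 1) expr1n mul1r.
    by rewrite divff.
  + rewrite !(rmorphM, fmorphV) /= rc_conj.
    rewrite (CrealP (normr_real (q _))) (CrealP (normr_real (D.[z]))).
    rewrite {1}(self_reversive_circle hE zc).
    by field; rewrite qx nD qJ.
- move=> z zc; have Dz := D0 _ (circle_cdisc zc).
  rewrite /H /H1 /H2 /= q0 /inner_of /= subr0 rc1 mul1r reversal_circle//.
  congr pair.
  have nD : `|D.[z]| != 0 by rewrite normr_eq0.
  by field; rewrite ?nD ?Dz.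
- move=> z zc; rewrite /H /H1 /H2 /= subrr rc0 !mul0r; congr pair.
  by rewrite q1 (CrealP cR) mulfK.
Qed.

(** * Zeros and multiplicities *)

Lemma conj_expi (x : R) : (expi x)^* = expi (- x).
Proof. by rewrite /expi cosN sinN. Qed.

Lemma expiD (x y : R) : expi (x + y) = expi x * expi y.
Proof. by rewrite /expi cosD sinD [X in (_ +i* X)%C]addrC. Qed.

(** Reversal turns X - tau into 1 - tau^* X = - tau^* (X - tau); the constant
    i e^(- i x / 2) is a square root of - tau^* and absorbs this factor. *)
Lemma self_reversive_circle_factor (x : R) :
  self_reversive 1 (('i * expi (- (x / 2))) *: ('X - (expi x)%:P)).
Proof.
apply: self_reversiveP => [|z zc].
  by rewrite (leq_trans (size_scale_leq _ _))// size_XsubC.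
have z0 := circle_neq0 zc.
have -> : expi x = expi (x / 2) * expi (x / 2) by rewrite -expiD -splitr.
have e0 := circle_neq0 (circle_expi (x / 2)).
rewrite -conj_expi hornerZ hornerXsubC !rmorphM rmorphB rmorphM /=.
rewrite conjCK conjCi (circle_conj zc) (circle_conj (circle_expi _)).
by field; rewrite z0 e0.
Qed.

Lemma self_reversive_ord_prod k (F : 'I_k -> {poly C}) :
  (forall i, self_reversive 1 (F i)) -> self_reversive k (\prod_(i < k) F i).
Proof.
elim: k F => [|k IH] F hF; first by rewrite big_ord0; exact: self_reversive1.
rewrite big_ord_recl; apply: (@self_reversiveM 1 k); first exact: hF.
by apply: IH => i; exact: hF.
Qed.

Lemma blaschke_denominator_neq0 a z : cdisc a -> cdisc z -> a != z \/ disc z ->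
  (1 - a^* *: 'X : {poly C}).[z] != 0.
Proof.
rewrite hornerD hornerN hornerZ hornerX hornerC => ad zd h.
rewrite subr_eq0; apply/eqP => e.
have nn : `|a| * `|z| = 1 by rewrite -norm_conjC -normrM -e normr1.
have z1 : `|z| = 1.
  apply: le_anti; rewrite (zd : `|z| <= 1) /= -nn.
  by rewrite ler_piMl.
have a1 : circle a by move: nn; rewrite z1 mulr1.
case: h => [/eqP az|]; last by rewrite /disc /= z1 ltxx.
apply: az; have a0 := circle_neq0 a1.
by rewrite -[LHS]mulr1 e (circle_conj a1) mulVKf.
Qed.

(** On the circle [a] is its own reflection, whence the double zero there. *)
Lemma mup_blaschke_pair a z : cdisc a -> cdisc z ->
  mup z (blaschke_pair a) =
  (if `|z| == 1 then ((a == z).*2)%N else (a == z)%N).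
Proof.
move=> ad zd; have X1 : @mup C z ('X - a%:P) = (a == z)%N.
  by rewrite -['X - _]expr1 mup_XsubCX; case: eqP.
have [->|zN] := eqVneq a z; last first.
  rewrite mupMl; first by rewrite X1 (negbTE zN) if_same.
  by apply: blaschke_denominator_neq0 => //; left.
have [z1|z1] := eqVneq `|z| 1; last first.
  rewrite mupMl; first by rewrite -['X - _]expr1 mup_XsubCX eqxx.
  apply: blaschke_denominator_neq0 => //; right.
  by rewrite /disc /= lt_neqAle z1.
have z0 : z != 0 := circle_neq0 z1.
have -> : blaschke_pair z = (- z^*)%:P * ('X - z%:P) ^+ 2.
  by rewrite blaschke_pairE// mul_polyC expr2 (circle_conj z1) invrK.
rewrite mupMr; first by rewrite mup_XsubCX eqxx.
by rewrite rootC oppr_eq0 conjC_eq0.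
Qed.

Lemma blaschke_prod_neq0 s : \prod_(a <- s) blaschke_pair a != 0.
Proof.
by rewrite prodf_seq_neq0; apply/allP => a _; exact: blaschke_pair_neq0.
Qed.

Lemma mup_blaschke_prod s z : (forall a, a \in s -> cdisc a) -> cdisc z ->
  mup z (\prod_(a <- s) blaschke_pair a) =
  (if `|z| == 1 then (count_mem z s).*2%N else count_mem z s).
Proof.
move=> + zd; elim: s => [|a s IH] sd.
  rewrite big_nil mupNroot; first by rewrite if_same.
  by rewrite rootE hornerC oner_eq0.
rewrite big_cons mupM ?blaschke_pair_neq0 ?blaschke_prod_neq0//.
rewrite IH; last by move=> b bs; apply: sd; rewrite inE bs orbT.
have ad : cdisc a by apply: sd; rewrite mem_head.
rewrite (mup_blaschke_pair ad zd) /=.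
by case: ifP; rewrite ?doubleD.
Qed.

Lemma root_of_mup z f : f != 0 -> (f.[z] == 0) = (0 < mup z f)%N.
Proof. by move=> f0; rewrite -XsubC_dvd// dvdp_XsubCl. Qed.

Lemma blaschke_prod_root s z : (forall a, a \in s -> cdisc a) -> cdisc z ->
  ((\prod_(a <- s) blaschke_pair a).[z] == 0) = (z \in s).
Proof.
move=> sd zd; rewrite root_of_mup ?blaschke_prod_neq0// mup_blaschke_prod//.
by case: ifP => _; rewrite ?double_gt0 -has_count has_pred1.
Qed.

(** * Spectral factors and the royal polynomial *)

Definition spectral_factor n P E D :=
  [/\ outer D, (size D <= n.+1)%N &
      forall z, circle z ->
        z ^- n * P.[z] + `|E.[z]| ^+ 2 = 4 * `|D.[z]| ^+ 2].

Lemma self_reversive_normsq n E z : self_reversive n E -> circle z ->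
  `|E.[z]| ^+ 2 = z ^- n * E.[z] ^+ 2.
Proof.
move=> hE zc; have z0 := circle_neq0 zc.
rewrite normCK expr2 {3}(self_reversive_circle hE zc).
by rewrite -mulrA mulKf ?expf_neq0// mulrC.
Qed.

Lemma spectral_factor_exists n P E :
  (size P <= n.*2.+1)%N -> self_reversive n E ->
  (forall z, circle z -> 0 < z ^- n * P.[z] + `|E.[z]| ^+ 2) ->
  exists D, spectral_factor n P E D.
Proof.
move=> sP hE pos.
have GE z : circle z ->
    z ^- n * (P + E ^+ 2).[z] = z ^- n * P.[z] + `|E.[z]| ^+ 2.
  by move=> zc; rewrite (self_reversive_normsq hE zc) hornerD horner_exp mulrDr.
have [||F [sF F0 FE]] := @fejer_riesz_pos n (P + E ^+ 2).
- rewrite (leq_trans (size_polyD _ _))// geq_max sP /=.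
  by rewrite expr2 -addnn; have [] := self_reversiveM hE hE.
- by move=> z zc; rewrite GE// pos.
have two0 : 2^-1 != 0 :> C by rewrite invr_eq0 pnatr_eq0.
exists (2^-1 *: F); split.
- by move=> z zd; rewrite hornerZ mulf_neq0// F0//; exact: disc_cdisc.
- by rewrite (leq_trans (size_scale_leq _ _)).
- move=> z zc; rewrite -GE// FE// hornerZ normrM exprMn normfV normr_nat.
  by field.
Qed.

(** The lower bound on z^-n P bounds |E| by 2 |D| on the circle; strict
    positivity of the sum extends the nonvanishing of D to the circle. *)
Lemma spectral_factor_inner_data n P E D : self_reversive n E ->
  (forall z, circle z -> 0 <= z ^- n * P.[z]) ->
  (forall z, circle z -> 0 < z ^- n * P.[z] + `|E.[z]| ^+ 2) ->
  spectral_factor n P E D -> inner_data n E D.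
Proof.
move=> hE P0 pos [oD sD DE].
have D0 z : cdisc z -> D.[z] != 0.
  move=> /cdiscP[zd|zc]; first exact: oD.
  by apply: contraTneq (pos z zc) => Dz; rewrite DE// Dz normr0 expr0n mulr0 ltxx.
split=> //.
have nE z : 2 * `|D.[z]| = `|(2 *: D).[z]| by rewrite hornerZ normrM normr_nat.
move=> z zd; rewrite nE; apply: (maximum_modulus _ _ zd) => w wd.
  by rewrite hornerZ mulf_neq0// ?D0// pnatr_eq0.
rewrite -(@ler_pXn2r _ 2)// ?nnegrE// -nE exprMn.
have -> : 2 ^+ 2 = 4 :> C by rewrite -natrX.
by rewrite -DE// lerDr P0.
Qed.

Lemma spectral_factor_royal n P E D : self_reversive n E ->
  spectral_factor n P E D -> P = 4 *: (D * reversal n D) - E ^+ 2.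
Proof.
move=> hE [_ sD DE]; apply: poly_circle_inj => z zc.
have z0 := circle_neq0 zc.
have zn0 : z ^+ n != 0 by rewrite expf_neq0.
rewrite hornerD hornerN hornerZ hornerM reversal_circle// horner_exp.
have -> : P.[z] = z ^+ n * (z ^- n * P.[z]) by rewrite mulVKf.
have -> : z ^- n * P.[z] = 4 * `|D.[z]| ^+ 2 - `|E.[z]| ^+ 2.
  by rewrite -DE// addrK.
by rewrite (self_reversive_normsq hE zc) normCK; field.
Qed.

(** With s = E / D and p = D~ / D, where D~ is the reversal of D, the point
    (s, p) is royal exactly when s^2 = 4 p; and 4 p - s^2 = P / D^2. *)
Lemma royal_nodeP n P E D z : inner_data n E D ->
  P = 4 *: (D * reversal n D) - E ^+ 2 ->
  royal_node (inner_of n E D) z <-> cdisc z /\ P.[z] = 0.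
Proof.
move=> [_ _ D0 _] PE.
suff H : cdisc z -> royal_variety (inner_of n E D z) <-> P.[z] = 0.
  by split=> -[zd /(H zd)].
move=> /D0 Dz.
have PzE : P.[z] = 4 * (D.[z] * (reversal n D).[z]) - E.[z] ^+ 2.
  by rewrite PE hornerD hornerN hornerZ hornerM horner_exp.
rewrite PzE /royal_variety /inner_of /=; split.
  move=> [w _ [wE wD]].
  have -> : E.[z] = 2 * w * D.[z] by rewrite wE divfK.
  have -> : (reversal n D).[z] = w ^+ 2 * D.[z] by rewrite wD divfK.
  by ring.
move=> /eqP; rewrite subr_eq0 => /eqP e.
exists (E.[z] / D.[z] / 2) => //; congr pair; first by field.
by rewrite !exprMn -e; field.
Qed.

(** The cofactor of the prescribed zeros has its zeros outside the closed disc: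
    they are the reflections of the entries of [alpha]. *)
Lemma Epoly_factor (t : R) k1 (alpha : seq C) (tau : k1.-tuple C)
    (theta : k1.-tuple R) : t != 0 -> (forall a, a \in alpha -> disc a) ->
  exists2 U : {poly C}, forall z, cdisc z -> U.[z] != 0 &
    Epoly t alpha tau theta = U * \prod_(a <- alpha ++ tau) ('X - a%:P).
Proof.
move=> t0 alphaD.
pose c := \prod_(j < k1) ('i * expi (- (tnth theta j / 2))).
exists ((rc t * c) *: \prod_(a <- alpha) (1 - a^* *: 'X)).
  move=> z zd; rewrite hornerZ mulf_neq0 ?mulf_neq0//.
  - by apply: contra_neq t0 => /complexI.
  - apply/prodf_neq0 => j _; rewrite mulf_neq0 ?neq0Ci//.
    exact/circle_neq0/circle_expi.
  - rewrite horner_prod prodf_seq_neq0; apply/allP => a aa /=.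
    have ad := alphaD a aa.
    apply: blaschke_denominator_neq0 => //; first exact: disc_cdisc.
    case/cdiscP: zd => [|zc]; [by right|left].
    by apply: contraTneq ad => ->; rewrite /disc /= (zc : `|z| = 1) ltxx.
rewrite /Epoly scaler_prod big_split /= big_cat /= [in RHS](big_tuple _ _ tau).
rewrite -/c -!scalerAl -!scalerAr scalerA; congr (_ *: _).
by rewrite [in RHS]mulrA [X in _ = X * _]mulrC.
Qed.

Lemma Epoly_self_reversive (t : R) k1 (alpha : seq C) (tau : k1.-tuple C)
    (theta : k1.-tuple R) :
  (forall j, tnth tau j = expi (tnth theta j)) ->
  self_reversive ((size alpha).*2 + k1) (Epoly t alpha tau theta).
Proof.
move=> tauE; apply/self_reversiveZ/self_reversiveM.
  exact: self_reversive_blaschke_prod.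
apply: self_reversive_ord_prod => j; rewrite tauE.
exact: self_reversive_circle_factor.
Qed.

Lemma Rpoly_circle (tp : R) s z : circle z ->
  z ^- size s * (Rpoly tp s).[z] = rc tp * \prod_(a <- s) `|z - a| ^+ 2.
Proof.
move=> zc; have z0 := circle_neq0 zc.
rewrite hornerZ mulrCA; congr (_ * _).
elim: s => [|a s IH]; first by rewrite !big_nil hornerC expr0 invr1 mul1r.
rewrite !big_cons hornerM -/(blaschke_pair a) blaschke_pair_circle// -IH /= exprS.
by field; rewrite z0 expf_neq0.
Qed.

End Construction.

Theorem theorem4p8 (R : realType) (n k0 k1 : nat)
    (alpha : k0.-tuple (Cplx R)) (tau : k1.-tuple (Cplx R))
    (sigma : n.-tuple (Cplx R))
    (n_gt0 : (0 < n)%N)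
    (alpha_disc : forall i, disc (tnth alpha i))
    (tau_circle : forall j, circle (tnth tau j))
    (k0k1n : (2 * k0 + k1 = n)%N)
    (sigma_cdisc : forall i, cdisc (tnth sigma i))
    (sigma_tau : forall i j, tnth sigma i <> tnth tau j) :
  (exists h : Cplx R -> Cplx R * Cplx R,
     [/\ rational_Gamma_inner h,
         Gamma_degree h n,
         cdisc_zeros_with_multiplicity (fun z => (h z).1) (alpha ++ tau) &
         royal_nodes_with_multiplicity h sigma])
  /\
  (forall (tp t : R) (theta : k1.-tuple R),
     0 < tp -> t != 0 ->
     (forall j, 0 <= tnth theta j < 2 * pi /\
                tnth tau j = expi (tnth theta j)) ->
     let P := Rpoly tp sigma in
     let E := Epoly t alpha tau theta in
     let spectral (D : {poly Cplx R}) :=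
       [/\ outer D, (size D <= n.+1)%N &
           forall z, circle z ->
             z ^- n * P.[z] + `|E.[z]| ^+ 2 = 4 * `|D.[z]| ^+ 2] in
     (exists D, spectral D) /\
     (forall D, spectral D ->
        let h := inner_of n E D in
        [/\ rational_Gamma_inner h,
            Gamma_degree h n,
            cdisc_zeros_with_multiplicity (fun z => (h z).1) (alpha ++ tau),
            royal_nodes_with_multiplicity h sigma &
            royal_polynomial h P])).
Proof.
have alphaD a : a \in tval alpha -> disc a by move=> /tnthP[i ->].
have tauC a : a \in tval tau -> circle a by move=> /tnthP[i ->].
have sigmaD a : a \in tval sigma -> cdisc a by move=> /tnthP[i ->].
have and_of (A B : Prop) : (B -> A) -> B -> A /\ B by auto.
(* the existence statement is the case of leading constants 1, for arguments
   of the tau_j in [0, 2 pi[ *)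
apply: and_of => [construction|].
  have [theta thetaE] : exists theta : k1.-tuple R, forall j,
      0 <= tnth theta j < 2 * pi /\ tnth tau j = expi (tnth theta j).
    have arg j : {x : R | 0 <= x < 2 * pi /\ tnth tau j = expi x}.
      by apply: cid; have [x] := circle_argument (tau_circle j); exists x.
    exists [tuple sval (arg j) | j < k1] => j.
    by rewrite tnth_mktuple; exact: (svalP (arg j)).
  have [[D hD] main] := construction 1 1 theta ltr01 (oner_neq0 _) thetaE.
  by exists (inner_of n (Epoly 1 alpha tau theta) D); case: (main D hD).
move=> tp t theta tp0 t0 thetaE P E spectral.
have hE : self_reversive n E.
  rewrite -k0k1n mul2n -{1}(size_tuple alpha).
  by apply: Epoly_self_reversive => j; case: (thetaE j).
have [U U0 EU] := Epoly_factor tau theta t0 alphaD.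
have linD a : a \in alpha ++ tau -> cdisc a.
  by rewrite mem_cat => /orP[/alphaD/disc_cdisc|/tauC/circle_cdisc].
have Eroot z : cdisc z -> (E.[z] == 0) = (z \in alpha ++ tau).
  move=> zd; rewrite /E EU hornerM mulf_eq0 (negbTE (U0 _ zd)) /=.
  by have := root_prod_XsubC (alpha ++ tau) z.
have Pcircle z : circle z ->
    z ^- n * P.[z] = rc tp * \prod_(a <- sigma) `|z - a| ^+ 2.
  by move=> zc; rewrite -[in LHS](size_tuple sigma); exact: Rpoly_circle.
have Pge0 z : circle z -> 0 <= z ^- n * P.[z].
  move=> zc; rewrite Pcircle// mulr_ge0 ?rc_ge0 ?(ltW tp0)//.
  by apply: prodr_ge0 => a _; rewrite exprn_ge0.
have pos z : circle z -> 0 < z ^- n * P.[z] + `|E.[z]| ^+ 2.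
  move=> zc; have zd := circle_cdisc zc.
  have [zs|zs] := boolP (z \in tval sigma).
    apply: ltr_wpDl; first exact: Pge0.
    rewrite exprn_gt0// normr_gt0 Eroot// mem_cat negb_or.
    apply/andP; split; apply/negP.
      by move=> /alphaD; rewrite /disc /= (zc : `|z| = 1) ltxx.
    move=> /tnthP[j zj]; have /tnthP[i zi] := zs.
    by apply: (@sigma_tau i j); rewrite -zi -zj.
  apply: ltr_wpDr; first by rewrite exprn_ge0.
  rewrite Pcircle// mulr_gt0 ?rc_gt0// big_seq.
  apply: prodr_gt0 => a sa; rewrite exprn_gt0// normr_gt0 subr_eq0.
  by apply: contraNneq zs => ->.
have PE : P = rc tp *: \prod_(a <- sigma) blaschke_pair a by [].
have rct0 : rc tp != 0 :> Cplx R by rewrite gt_eqF// rc_gt0.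
have P0 : P != 0 by rewrite PE scaler_eq0 negb_or rct0 blaschke_prod_neq0.
have sP : (size P <= n.*2.+1)%N.
  rewrite PE (leq_trans (size_scale_leq _ _))//.
  by have [+ _] := self_reversive_blaschke_prod sigma; rewrite size_tuple.
have Proot z : cdisc z -> (P.[z] == 0) = (z \in tval sigma).
  move=> zd; rewrite PE hornerZ mulf_eq0 (negbTE rct0) /=.
  exact: blaschke_prod_root.
split; first exact: spectral_factor_exists.
move=> D hD h.
have data : inner_data n E D by exact: spectral_factor_inner_data hD.
have PDE := spectral_factor_royal hE hD.
have hdeg : Gamma_degree h n := inner_of_degree data.
have royal : royal_polynomial h P.
  case: data => -[sE rE] sD D0 ED; exists n, E, D; split=> // z zd.
  by split; [exact: D0|exact: ED|].
have nodeP z : royal_node h z <-> z \in tval sigma.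
  apply: (iff_trans (royal_nodeP z data PDE)); split.
    by move=> [zd /eqP]; rewrite Proot.
  move=> zs; have zd := sigmaD z zs; split=> //.
  by apply/eqP; rewrite Proot.
have [_ _ D0 _] := data.
split=> //.
- exact: inner_of_rational_Gamma_inner.
- split=> z.
    split=> [[zd /eqP]|zat].
      by rewrite /h /= mulf_eq0 invr_eq0 (negbTE (D0 _ zd)) orbF Eroot.
    have zd := linD z zat; split=> //.
    by rewrite /h /=; move: zat; rewrite -Eroot// => /eqP ->; rewrite mul0r.
  move=> zat; have zd := linD z zat; exists E, D; split.
  + by move=> w wd; split=> //; exact: D0.
  + have UN0 : U != 0.
      by apply: contraNneq (U0 z zd) => ->; rewrite horner0.
    by rewrite /E EU mulf_neq0// monic_neq0// monic_prod_XsubC.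
  + by rewrite /E EU mupMr ?mu_prod_XsubC//; exact: U0.
- split=> // z zs; have zd := sigmaD z zs; split; first exact/nodeP.
    move=> sub; case/eqP: P0; apply: poly_circle_eq0 => z1 z1c.
    have z1d := circle_cdisc z1c.
    have [|+ _] := sub (h z1); first by exists z1.
    by move=> hr; have [] := (royal_nodeP z1 data PDE).1 (conj z1d hr).
  have mupP : mup z P = mup z (\prod_(a <- sigma) blaschke_pair a).
    by rewrite PE -mul_polyC mupMr// rootC.
  exists P; split=> //.
    move=> zD; rewrite mupP mup_blaschke_prod//.
    by rewrite lt_eqF.
  move=> zc; rewrite mupP mup_blaschke_prod//.
  by rewrite (zc : `|z| = 1) eqxx.
Qed.
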